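(* Let $E$ be a finite nonempty set and $u:2^E\to\mathbb{R}$ an ordinally concave function. Consider the following algorithm: start with $W=\emptyset$; while $\emptyset$ is not a local maximizer of the contraction $u_W$, choose any $x^*\in\operatorname{Arg}\max\{u(W\cup\{x\})\mid x\in E\setminus W\}$ and update $W\gets W\cup\{x^*\}$; finally return $W$. Then this algorithm returns a maximizer of $u$ over $2^E$, and it requires $\mathrm{O}(|E|^2)$ evaluations of $u$ in total.
   Context: Notation: for $X\subseteq E$ and $x\in E\setminus X$, $X+x=X\cup\{x\}$; for $x\in X$, $X-x=X\setminus\{x\}$. The symbol $\emptyset$ is also used as a formal element not in $E$, with $X+\emptyset=X-\emptyset=X$. A function $u:2^E\to\mathbb{R}$ is ordinally concave if for every $X,X'\in 2^E$ and every $x\in X\setminus X'$ there exists $x'\in(X'\setminus X)\cup\{\emptyset\}$ such that (i) $u(X)<u(X-x+x')$, or (ii) $u(X')<u(X'-x'+x)$, or (iii) $u(X)=u(X-x+x')$ and $u(X')=u(X'-x'+x)$. For $W\subseteq E$, the contraction $u_W:2^{E\setminus W}\to\mathbb{R}$ is $u_W(Z)=u(Z\cup W)-u(W)$. For a function $v$ on $2^F$, the neighborhood of $X\subseteq F$ is $\mathbf{N}(X)=\{X-x+x'\mid x\in X\cup\{\emptyset\},\ x'\in(F\setminus X)\cup\{\emptyset\}\}$, and $X$ is a local maximizer of $v$ if $v(X)\ge v(Z)$ for all $Z\in\mathbf{N}(X)$. (When $W=E$, $\emptyset$ is trivially a local maximizer of $u_W$.) *)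

(* Defs.v *)
From mathcomp Require Import all_boot all_order all_algebra.
From mathcomp Require Import reals.

Set Implicit Arguments.
Unset Strict Implicit.
Unset Printing Implicit Defensive.

Import Order.TTheory GRing.Theory Num.Theory.
Local Open Scope ring_scope.

(** The formal element "∅ ∉ E" is [None : option E]. *)
Section FormalElement.
Variable E : finType.
Implicit Types (A X : {set E}) (o : option E).

Definition with_null A : {set option E} := None |: [set Some x | x in A].

Definition addo X o : {set E} := if o is Some x then x |: X else X.

Definition delo X o : {set E} := if o is Some x then X :\ x else X.

End FormalElement.

Section SetFunctions.
Variables (R : realType) (E : finType).
Implicit Types (u v : {set E} -> R) (F W X Z : {set E}).

Definition ordinally_concave u : Prop :=
  forall (X X' : {set E}) (x : E), x \in X :\: X' ->
  exists2 x' : option E, x' \in with_null (X' :\: X) &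
  [\/ u X < u (addo (X :\ x) x'),
      u X' < u (x |: delo X' x')
    | u X = u (addo (X :\ x) x') /\ u X' = u (x |: delo X' x')].

(** A function on 2^F with F ⊆ E is represented by a function on {set E}, of
    which only the values at subsets of F are used: F = E \ W for the
    contraction by W. *)
Definition contraction u W : {set E} -> R := fun Z => u (Z :|: W) - u W.

Definition neighborhood F X : {set {set E}} :=
  [set addo (delo X x) x' | x in with_null X, x' in with_null (F :\: X)].

Definition local_maximizer F v X : bool :=
  [forall Z in neighborhood F X, v Z <= v X].

Definition maximizer u X : Prop := forall Z, u Z <= u X.

Definition argmax_set (f : E -> R) (A : {set E}) : {set E} :=
  [set x in A | [forall y in A, f y <= f x]].

End SetFunctions.

(** Programs that access the set function only through evaluation queries,
    and may make nondeterministic choices from a finite set. *)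
Section OraclePrograms.
Variables (R : realType) (E : finType).

Inductive oracle_prog (A : Type) : Type :=
| Ret of A
| Eval of {set E} & (R -> oracle_prog A)
| Choose of {set E} & (E -> oracle_prog A).

(** [exec u p n a]: some run of [p] with oracle [u] yields [a] after exactly
    [n] evaluations of [u]. *)
Inductive exec (A : Type) (u : {set E} -> R) :
    oracle_prog A -> nat -> A -> Prop :=
| exec_ret a : exec u (Ret a) 0 a
| exec_eval X k n a : exec u (k (u X)) n a -> exec u (Eval X k) n.+1 a
| exec_choose (S : {set E}) k x n a :
    x \in S -> exec u (k x) n a -> exec u (Choose S k) n a.

(** Evaluates the oracle at each member of [s] in turn and passes on the table
    [t] updated with the answers. *)
Fixpoint eval_all (A : Type) (s : seq {set E}) (t : {set E} -> R)
    (k : ({set E} -> R) -> oracle_prog A) : oracle_prog A :=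
  if s is X :: s' then
    Eval X (fun r => eval_all s' (fun Y => if Y == X then r else t Y) k)
  else k t.

End OraclePrograms.

Section Greedy.
Variables (R : realType) (E : finType).
Implicit Types (u : {set E} -> R) (W : {set E}).

Inductive outcome : Type := Halt of {set E} | Continue of {set E}.

(** One pass through the while loop. The table [t] agrees with the oracle at W
    and at every W ∪ {x} (x ∉ W), and the loop test and the Arg max depend on
    no other value: see [exec_iteration_Halt] and [exec_iteration_Continue]. *)
Definition iteration W : oracle_prog R E outcome :=
  eval_all (W :: [seq x |: W | x <- enum (~: W)]) (fun _ => 0) (fun t =>
    if local_maximizer (~: W) (contraction t W) set0 then
      Ret R E (Halt W)
    else
      Choose (argmax_set (fun x => t (x |: W)) (~: W))
        (fun x => Ret R E (Continue (x |: W)))).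

(** [greedy_run u W n W']: some run of the while loop from state [W] returns
    [W'] after [n] evaluations of [u] in total. *)
Inductive greedy_run u : {set E} -> nat -> {set E} -> Prop :=
| greedy_halt W n W' :
    exec u (iteration W) n (Halt W') -> greedy_run u W n W'
| greedy_continue W n W1 m W' :
    exec u (iteration W) n (Continue W1) -> greedy_run u W1 m W' ->
    greedy_run u W (n + m) W'.

(** Every run of the while loop from state [W], whatever the choices made,
    reaches a returned value: none gets stuck, none is infinite. *)
Inductive greedy_terminates u : {set E} -> Prop :=
| GreedyTerminates W :
    (exists n o, exec u (iteration W) n o) ->
    (forall n W1, exec u (iteration W) n (Continue W1) ->
       greedy_terminates u W1) ->
    greedy_terminates u W.

End Greedy.

Section IterationSpec.
Variables (R : realType) (E : finType).
Implicit Types (u : {set E} -> R) (W : {set E}).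

Lemma exec_RetP A u (a b : A) n : exec u (Ret R E a) n b -> n = 0%N /\ b = a.
Proof. by move=> ex; inversion ex. Qed.

Lemma exec_ChooseP A u S (k : E -> oracle_prog R E A) n a :
  exec u (Choose S k) n a -> exists2 x, x \in S & exec u (k x) n a.
Proof. by move=> ex; inversion ex; subst; exists x. Qed.

Lemma exec_eval_all A u s t (k : ({set E} -> R) -> oracle_prog R E A) n a :
  exec u (eval_all s t k) n a ->
  exists t', [/\ {in s, t' =1 u}, (size s <= n)%N &
                 exec u (k t') (n - size s) a].
Proof.
suff H s' : forall t n, {in s', t =1 u} -> exec u (eval_all s t k) n a ->
  exists t', [/\ {in s' ++ s, t' =1 u}, (size s <= n)%N &
                 exec u (k t') (n - size s) a].
  exact: (H [::]).
elim: s s' => [|X s IH] s' {}t {}n ts' /=.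
  by move=> ?; exists t; rewrite cats0 subn0.
move=> ex; inversion ex; subst => //.
have [|t' [h1 h2 h3]] := IH (rcons s' X) _ _ _ H3.
  move=> Y; rewrite mem_rcons inE; case: eqP => [-> //|_ /= /ts' //].
by exists t'; rewrite -cat_rcons subSS.
Qed.

Lemma eval_all_exec A u s t (k : ({set E} -> R) -> oracle_prog R E A) n a :
  (forall t', {in s, t' =1 u} -> exec u (k t') n a) ->
  exec u (eval_all s t k) (size s + n) a.
Proof.
suff H s' : forall t, {in s', t =1 u} ->
  (forall t', {in s' ++ s, t' =1 u} -> exec u (k t') n a) ->
  exec u (eval_all s t k) (size s + n) a.
  exact: (H [::]).
elim: s s' => [|X s IH] s' {}t ts' hk /=.
  by apply: hk; rewrite cats0.
rewrite addSn; constructor; apply: (IH (rcons s' X)).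
  move=> Y; rewrite mem_rcons inE; case: eqP => [-> //|_ /= /ts' //].
by move=> t' h; apply: hk; rewrite -cat_rcons.
Qed.

Lemma neighborhood_set0 (F Z : {set E}) : Z \in neighborhood F set0 ->
  Z = set0 \/ exists2 x, x \in F & Z = [set x].
Proof.
case/imset2P=> x x'; rewrite !inE => /orP[/eqP->|/imsetP[y]]; last by rewrite inE.
case/orP=> [/eqP-> -> | /imsetP[y]]; first by left.
by rewrite !inE => /= yF -> -> /=; right; exists y; rewrite // setU0.
Qed.

Let queries W := W :: [seq x |: W | x <- enum (~: W)].

Lemma size_queries W : size (queries W) = #|~: W|.+1.
Proof. by rewrite /= size_map -cardE. Qed.

Lemma queries_add u t W : {in queries W, t =1 u} ->
  {in ~: W, forall x, t (x |: W) = u (x |: W)}.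
Proof.
move=> h x xW; apply: h; rewrite inE; apply/orP; right.
by apply/mapP; exists x; rewrite ?mem_enum.
Qed.

Lemma queries_local_maximizer u t W : {in queries W, t =1 u} ->
  local_maximizer (~: W) (contraction t W) set0 =
  local_maximizer (~: W) (contraction u W) set0.
Proof.
move=> h; apply: eq_forallb_in => Z /neighborhood_set0.
have tW : t W = u W by apply: h; rewrite mem_head.
case=> [-> //|[x xW ->]]; rewrite /contraction ?set0U ?tW //.
by rewrite (queries_add h).
Qed.

Lemma queries_argmax u t W : {in queries W, t =1 u} ->
  argmax_set (fun x => t (x |: W)) (~: W) =
  argmax_set (fun x => u (x |: W)) (~: W).
Proof.
move=> h; apply/setP => x; rewrite !inE; case: (boolP (x \in W)) => //= xW.
apply: eq_forallb_in => y yW.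
by rewrite !(queries_add h) // inE.
Qed.

Lemma exec_iteration_Halt u W n W' :
  exec u (iteration R W) n (Halt W') <->
  [/\ local_maximizer (~: W) (contraction u W) set0, W' = W
    & n = #|~: W|.+1].
Proof.
split.
  move=> ex0; have [t] := exec_eval_all (s := queries W) ex0.
  rewrite size_queries => -[h le_n].
  rewrite (queries_local_maximizer h); case: ifP => lm.
    move=> ex; have [/eqP] := exec_RetP ex; rewrite subn_eq0 => ge_n [->].
    by split=> //; apply/eqP; rewrite eqn_leq ge_n.
  by move=> ex; have [x _ ex'] := exec_ChooseP ex; have [] := exec_RetP ex'.
case=> lm -> ->; rewrite -size_queries -[size _]addn0.
by apply: eval_all_exec => t /queries_local_maximizer ->; rewrite lm; constructor.
Qed.

Lemma exec_iteration_Continue u W n W' :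
  exec u (iteration R W) n (Continue W') <->
  [/\ ~~ local_maximizer (~: W) (contraction u W) set0,
      exists2 x, x \in argmax_set (fun x => u (x |: W)) (~: W) & W' = x |: W
    & n = #|~: W|.+1].
Proof.
split.
  move=> ex0; have [t] := exec_eval_all (s := queries W) ex0.
  rewrite size_queries => -[h le_n].
  rewrite (queries_local_maximizer h) (queries_argmax h); case: ifP => lm.
    by move=> ex; have [] := exec_RetP ex.
  move=> ex; have [x xA ex'] := exec_ChooseP ex.
  have [/eqP] := exec_RetP ex'; rewrite subn_eq0 => ge_n [->].
  by split=> //; [exists x | apply/eqP; rewrite eqn_leq ge_n].
case=> nlm [x xA ->] ->; rewrite -size_queries -[size _]addn0.
apply: eval_all_exec => t h.
rewrite (queries_local_maximizer h) (queries_argmax h) (negbTE nlm).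
by apply: (exec_choose xA); constructor.
Qed.

End IterationSpec.

(* Main.v *)
Require Import Defs.
From mathcomp Require Import all_boot all_order all_algebra.
From mathcomp Require Import reals zify.

(** The loop keeps the invariant that [W] is contained in some maximizer [X] of
    [u]. If [x*] is a best addition to [W], strictly improving and not in [X],
    ordinal concavity at [W + x*] and [X] exchanges [x*] with some [x'] of
    [X \ W] or with the null element; neither strict improvement is possible, so
    [X - x' + x*] is again a maximizer. When the loop stops, ordinal concavity at
    a maximizer [X] containing [W] and at [W] shows that the elements of [X \ W]
    can be removed one by one without leaving the maximizers. *)

Set Implicit Arguments.
Unset Strict Implicit.
Unset Printing Implicit Defensive.

Import Order.TTheory GRing.Theory Num.Theory.
Local Open Scope ring_scope.

Section Greedy.
Variables (R : realType) (E : finType).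
Implicit Types (u : {set E} -> R) (W X : {set E}) (x : E).

Lemma with_nullP (A : {set E}) (o : option E) :
  o \in with_null A -> o = None \/ exists2 x, x \in A & o = Some x.
Proof.
by rewrite !inE => /orP[/eqP->|/imsetP[x xA ->]]; [left|right; exists x].
Qed.

(** The neighbors of the empty set are itself and the singletons, and the constant [u W] cancels
    from both sides of the comparison. *)
Lemma local_maximizer_set0P u W :
  reflect {in ~: W, forall x, u (x |: W) <= u W}
          (local_maximizer (~: W) (contraction u W) set0).
Proof.
have le_contr Z : (contraction u W Z <= contraction u W set0) =
    (u (Z :|: W) <= u W) by rewrite /contraction set0U lerD2r.
apply: (iffP forall_inP) => [lm x xW | le_u Z].
  rewrite -le_contr; apply: lm; apply/imset2P; exists None (Some x).
  - by rewrite !inE.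
  - by rewrite setD0 !inE; apply/orP; right; apply/imsetP; exists x.
  - by rewrite /= setU0.
rewrite le_contr => /neighborhood_set0[->|[x xW ->]]; first by rewrite set0U.
exact: le_u.
Qed.

Lemma argmax_set_neq0 (f : E -> R) (A : {set E}) x :
  x \in A -> exists y, y \in argmax_set f A.
Proof.
move=> xA; case: (@Order.TotalTheory.arg_maxP _ _ _ x (fun y => y \in A) f xA) => y yA le_y.
by exists y; rewrite inE; apply/andP; split=> //; apply/forall_inP.
Qed.

Lemma maximizer_exists u : exists X, maximizer u X.
Proof.
case: (@Order.TotalTheory.arg_maxP _ _ _ set0 predT u isT) => X _ le_X.
by exists X => Z; apply: le_X.
Qed.

Lemma maximizer_eq u X X' : maximizer u X -> u X = u X' -> maximizer u X'.
Proof. by move=> maxX eqX Z; rewrite -eqX. Qed.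

Lemma greedy_step_maximizer u W X x :
    ordinally_concave u -> maximizer u X -> W \subset X ->
    ~~ local_maximizer (~: W) (contraction u W) set0 ->
    x \in argmax_set (fun x => u (x |: W)) (~: W) ->
  exists2 X', maximizer u X' & x |: W \subset X'.
Proof.
move=> concu maxX sWX nlm; rewrite inE => /andP[xW /forall_inP le_x].
(* Otherwise no element would improve on [W], since [x] is a best one. *)
have lt_u : u W < u (x |: W).
  rewrite ltNge; apply: contra nlm => le_W.
  by apply/local_maximizer_set0P => y yW; apply: le_trans (le_x _ yW) le_W.
rewrite inE in xW.
have [xX|xX] := boolP (x \in X); first by exists X => //; rewrite subUset sub1set xX.
have xD : x \in (x |: W) :\: X by rewrite !inE eqxx xX.
have [o /with_nullP o_in] := concu _ _ _ xD.
rewrite setU1K // => -[|/lt_geF|[_ eqX]].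
(* A strict gain at [x |: W] would lead either back to [W], contradicting [lt_u], or to [y |: W],
   contradicting the choice of [x]. *)
- case: o_in => [->|[y yA ->]] /=; first by rewrite ltNge (ltW lt_u).
  rewrite ltNge le_x // inE.
  by move: yA; rewrite !inE negb_or => /andP[/andP[]].
- by rewrite maxX.
- exists (x |: delo X o); first exact: maximizer_eq eqX.
  (* The element given up by [X] lies outside [W], so [W] survives the exchange. *)
  apply: setUS; case: o_in => [-> //|[y yA ->]] /=.
  rewrite subsetD1 sWX /=.
  by move: yA; rewrite !inE negb_or => /andP[/andP[]].
Qed.

Lemma greedy_halt_maximizer u W X :
    ordinally_concave u -> maximizer u X -> W \subset X ->
    local_maximizer (~: W) (contraction u W) set0 ->
  maximizer u W.
Proof.
move=> concu + + /local_maximizer_set0P le_W.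
have [m] := ubnP #|X|; elim: m X => // m IH X lt_m maxX sWX.
have [sXW|/subsetPn[x xX xW]] := boolP (X \subset W).
  by suff -> : W = X by []; apply/eqP; rewrite eqEsubset sWX.
have xD : x \in X :\: W by rewrite inE xW.
have [o /with_nullP o_in] := concu _ _ _ xD.
(* As [W] is contained in [X], only the null element is available for the exchange. *)
have {o_in}-> : o = None.
  by case: o_in => // -[y]; rewrite inE => /andP[/negP yX /(subsetP sWX)].
case=> /= [/lt_geF|/lt_geF|[eqX _]].
- by rewrite maxX.
- by rewrite le_W // inE.
- apply: (IH (X :\ x)); last by rewrite subsetD1 sWX.
  + by move: lt_m; rewrite (cardsD1 x) xX.
  + exact: maximizer_eq eqX.
Qed.

Lemma card_setCU1 W x : x \in ~: W -> #|~: W| = #|~: (x |: W)|.+1.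
Proof.
move=> xW; rewrite (cardsD1 x) xW; congr _.+1.
by apply: eq_card => y; rewrite !inE negb_or.
Qed.

(** Each pass shrinks the complement of [W]. No pass gets stuck: if the loop test fails, that
    complement is nonempty, hence so is the Arg max. *)
Lemma greedy_terminates_from u W : greedy_terminates u W.
Proof.
have [m] := ubnP #|~: W|; elim: m W => [W|m IH W lt_m]; first by rewrite ltn0.
constructor.
  have [lm|nlm] := boolP (local_maximizer (~: W) (contraction u W) set0).
    by exists #|~: W|.+1, (Halt W); apply/exec_iteration_Halt.
  have [W0|[x xW]] := set_0Vmem (~: W).
    case/negP: nlm; apply/local_maximizer_set0P => x.
    by rewrite W0 inE.
  have [y yA] := argmax_set_neq0 (fun x => u (x |: W)) xW.
  exists #|~: W|.+1, (Continue (y |: W)); apply/exec_iteration_Continue.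
  by split=> //; exists y.
move=> n W1 /exec_iteration_Continue[_ [x xA ->] _]; apply: IH.
by move: xA lt_m; rewrite inE => /andP[xW _]; rewrite (card_setCU1 xW).
Qed.

Lemma greedy_run_maximizer u W n W' X :
    ordinally_concave u -> greedy_run u W n W' ->
    maximizer u X -> W \subset X ->
  maximizer u W'.
Proof.
(* [X] is generalized because each pass may replace the maximizer that contains the current set. *)
move=> concu run; elim: run X => {W n W'}
  [W n W' /exec_iteration_Halt[lm -> _] X maxX sWX | W n W1 m W'].
  apply: (greedy_halt_maximizer concu maxX sWX lm).
case/exec_iteration_Continue=> nlm [x xA ->] _ _ IH Y maxY sWY.
have [Z maxZ sZ] := greedy_step_maximizer concu maxY sWY nlm xA.
exact: IH sZ.
Qed.

(** With k elements outside [W], a pass costs k + 1 evaluations, and k + 1 + k^2 <= (k + 1)^2 closes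
    the induction. *)
Lemma greedy_run_evals u W n W' :
  greedy_run u W n W' -> (n <= #|~: W|.+1 ^ 2)%N.
Proof.
elim=> {W n W'} [W n W' /exec_iteration_Halt[_ _ ->] | W n W1 m W'].
  by nia.
case/exec_iteration_Continue=> _ [x xA ->] -> _.
by move: xA; rewrite inE => /andP[/card_setCU1 -> _]; nia.
Qed.

End Greedy.

Theorem theorem2p14 (R : realType) :
  exists C : nat, forall (E : finType) (u : {set E} -> R),
    (0 < #|E|)%N -> ordinally_concave u ->
    greedy_terminates u set0 /\
    (forall (n : nat) (W : {set E}), greedy_run u set0 n W ->
       maximizer u W /\ (n <= C * #|E| ^ 2)%N).
Proof.
(* The constant 4 comes from (e + 1)^2 <= (2 e)^2 for e >= 1, where e is the size of [E]. *)
exists 4%N => E u E_gt0 concu; split; first exact: greedy_terminates_from.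
move=> n W run; split.
  have [X maxX] := maximizer_exists u.
  exact: (greedy_run_maximizer concu run maxX (sub0set X)).
by have := greedy_run_evals run; rewrite setC0 cardsT; nia.
Qed.
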